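(* Let $S$ and $T$ be two finite trees, each on at least $3$ vertices. If $\vec{d}(S)\neq\vec{d}(T)$, then $\delta(S,T)>0$, where $$\delta(S,T)=\lim_{n\to\infty}\mathrm{TV}\big(\mathrm{PA}(n,S),\mathrm{PA}(n,T)\big).$$
   Context: For $n\ge k\ge 2$ and a tree $T$ on $k$ vertices, the random tree $\mathrm{PA}(n,T)$ is defined inductively: $\mathrm{PA}(k,T)=T$, and $\mathrm{PA}(n+1,T)$ is obtained from $\mathrm{PA}(n,T)$ by adding a new vertex $u$ and one edge $uv$, where $v$ is chosen among the vertices of $\mathrm{PA}(n,T)$ with probability $d_{\mathrm{PA}(n,T)}(v)/(2(n-1))$ ($d_G(v)$ denotes degree). $\mathrm{TV}$ denotes total variation distance between the laws of the random trees (viewed up to isomorphism); $\mathrm{TV}(\mathrm{PA}(n,S),\mathrm{PA}(n,T))$ is non-increasing in $n$ for $n\ge\max(|S|,|T|)$, so the limit exists. For a tree $T$, the degree profile $\vec{d}(T)\in\mathbb{N}^{\mathbb{N}}$ is the vector of vertex degrees of $T$ arranged in decreasing order, continued by zeros after the $|T|$-th coordinate. *)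

(* Defs.v *)
From HB Require Import structures.
From mathcomp Require Import all_boot all_order all_algebra all_fingroup.
From mathcomp Require Import all_classical all_reals all_analysis.
Set Implicit Arguments. Unset Strict Implicit. Unset Printing Implicit Defensive.
Import Order.TTheory GRing.Theory Num.Theory numFieldTopology.Exports numFieldNormedType.Exports.
Local Open Scope ring_scope.

(* A graph on vertex set {0,...,n-1} is given by a list of (undirected) edges. *)
Definition edges := seq (nat * nat)%type.

Definition adj (E : edges) (u v : nat) : bool := ((u, v) \in E) || ((v, u) \in E).

(* E is a tree on vertex set {0,...,k-1}: no loops, edges inside the vertex set,
   exactly k-1 edges and connected (this forces a simple tree). *)
Definition is_tree (k : nat) (E : edges) : Prop :=
  [/\ all (fun e => [&& (e.1 < k)%N, (e.2 < k)%N & e.1 != e.2]) E,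
      size E = k.-1 &
      forall u v : 'I_k, connect (fun x y : 'I_k => adj E x y) u v].

Definition deg (E : edges) (v : nat) : nat :=
  (\sum_(e <- E) ((e.1 == v) + (e.2 == v)))%N.

Definition dprof (k : nat) (E : edges) : nat -> nat :=
  fun i => nth 0%N (sort geq [seq deg E v | v <- iota 0 k]) i.

(* finitely supported distributions on labelled trees, as (probability, tree) lists *)
Definition pa_step (R : realType) (m : nat) (D : seq (R * edges)) : seq (R * edges) :=
  flatten [seq [seq (p.1 * ((deg p.2 v)%:R / (2 * (m - 1))%:R), (m, v) :: p.2)
               | v <- iota 0 m] | p <- D].

(* law of PA(k + j, T) where T = E is a tree on {0,...,k-1}; new vertices are
   labelled k, k+1, ... *)
Fixpoint pa_iter (R : realType) (k : nat) (E : edges) (j : nat) : seq (R * edges) :=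
  match j with
  | 0 => [:: (1, E)]
  | j'.+1 => pa_step (k + j') (pa_iter R k E j')
  end.

Definition PA (R : realType) (n k : nat) (E : edges) : seq (R * edges) :=
  pa_iter R k E (n - k).

Definition Prob (R : realType) (D : seq (R * edges)) (A : edges -> bool) : R :=
  \sum_(p <- D) (if A p.2 then p.1 else 0).

Definition iso (n : nat) (E F : edges) : Prop :=
  exists f : {perm 'I_n}, forall u v : 'I_n,
    adj E (nat_of_ord u) (nat_of_ord v) = adj F (nat_of_ord (f u)) (nat_of_ord (f v)).

(* events invariant under isomorphism (i.e. events about the unlabelled tree) *)
Definition iso_invariant (n : nat) (A : edges -> bool) : Prop :=
  forall E F, iso n E F -> A E = A F.

Definition TV (R : realType) (n kS : nat) (ES : edges) (kT : nat) (ET : edges) : R :=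
  sup [set r : R | exists A, iso_invariant n A /\
        r = `| Prob (PA R n kS ES) A - Prob (PA R n kT ET) A |].

Definition delta (R : realType) (kS : nat) (ES : edges) (kT : nat) (ET : edges) : R :=
  limn (fun n : nat => TV R n kS ES kT ET).

(* Main.v *)
(** If [d] is the degree of a vertex of a tree on [n] vertices, one attachment step
    multiplies the conditional mean of the rising factorial [d (d+1) ... (d+2s-1)] by
    exactly [1 + s/(n-1)].  Hence, with [X] the sum of these over all vertices and
    [c = (2s)!/(s-1)], the mean of [X + c (n-1)] is multiplied by [1 + s/(n-1)] at each
    step.  The off-diagonal part of [X^2], up to a lower-order correction, grows at most by
    factors [1 + 2s/(n-1)], and its diagonal part is below the same statistic with [2s] in place of [s]; so after
    normalization the second moment stays bounded, and a difference of means between the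
    two seeds at one time keeps the total variation distance away from [0] forever.

    Let the smaller seed grow to the size of the larger one.  If the expected numbers of
    vertices of degree [d] then differ for some [d], the largest such [d] dominates for
    large [s] and the means of [X] differ.  For seeds of equal size this is the hypothesis
    on degree profiles.  Otherwise let [D] be the maximal degree of the smaller seed and
    [t > 0] the difference of sizes: the expected number of vertices of degree [D + t] lies
    strictly between [0] and [1], whereas for the larger seed it is an integer. *)

Require Import Defs.
From HB Require Import structures.
From mathcomp Require Import all_boot all_order all_algebra all_fingroup.
From mathcomp Require Import all_classical all_reals all_analysis.
From mathcomp Require Import ring lra zify.
Import Order.TTheory GRing.Theory Num.Theory numFieldTopology.Exports numFieldNormedType.Exports.
Set Implicit Arguments. Unset Strict Implicit.
Local Open Scope ring_scope.

(** * Degrees in trees *)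

Lemma adjC (E : edges) u v : adj E u v = adj E v u.
Proof. by rewrite /adj orbC. Qed.

Lemma adj_cons (e : nat * nat) (E : edges) u v :
  adj (e :: E) u v = [|| (u, v) == e, (v, u) == e | adj E u v].
Proof. by rewrite /adj !inE orbACA -orbA. Qed.

Lemma deg_cons (e : nat * nat) (E : edges) v :
  deg (e :: E) v = ((e.1 == v) + (e.2 == v) + deg E v)%N.
Proof. by rewrite /deg big_cons. Qed.

Definition adeg (n : nat) (E : edges) (v : nat) : nat := (\sum_(u < n) adj E v u)%N.

Fixpoint simple (E : edges) : bool :=
  if E is e :: F then [&& e.1 != e.2, ~~ adj F e.1 e.2 & simple F] else true.

Definition inside (n : nat) (E : edges) : bool :=
  all (fun e => (e.1 < n)%N && (e.2 < n)%N) E.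

Lemma inside_adj n E u v : inside n E -> adj E u v -> (u < n)%N /\ (v < n)%N.
Proof. by move=> /allP h /orP[] /h /andP[]. Qed.

Lemma sum_eq_ord (n v : nat) : (\sum_(u < n) ((v == u) : nat) = (v < n))%N.
Proof.
case: (ltnP v n) => h.
  rewrite (bigD1 (Ordinal h)) //= eqxx big1 // => i /eqP hi.
  by case: eqP => // e; case: hi; apply: val_inj.
by rewrite big1 // => i _; case: eqP => // e; move: h; rewrite e leqNgt ltn_ord.
Qed.

Lemma simple_adeg n E v : inside n E -> simple E -> (v < n)%N -> deg E v = adeg n E v.
Proof.
move=> + + hv; elim: E => [|[a b] E IH] /=.
  by move=> _ _; rewrite /deg /adeg big_nil big1.
move=> /andP[/andP[/= ha hb] hE] /and3P[/= ab nab hs].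
rewrite deg_cons /= IH // /adeg.
transitivity (\sum_(u < n) ((a == v) && (b == u) + ((b == v) && (a == u)) + adj E v u))%N.
  rewrite !big_split /=; congr (_ + _ + _)%N.
    by case: (a == v) => /=; rewrite ?sum_eq_ord ?hb // big1.
  by case: (b == v) => /=; rewrite ?sum_eq_ord ?ha // big1.
apply: eq_bigr => u _; rewrite adj_cons !xpair_eqE.
rewrite ![_ == a]eq_sym ![_ == b]eq_sym.
have h1 : ~~ ((a == v) && (b == v)) by apply: contra ab => /andP[/eqP-> /eqP->].
have h2 : a == v -> b == u -> ~~ adj E v u by move=> /eqP<- /eqP<-.
have h3 : a == u -> b == v -> ~~ adj E v u by move=> /eqP<- /eqP<-; rewrite adjC.
move: h1 h2 h3; case: (a == v); case: (b == u); case: (a == u); case: (b == v) => //=;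
  case: (adj E v u) => //=; by move=> _ h1 h2; (have := h1 isT isT) || (have := h2 isT isT).
Qed.

Lemma sum_deg n E : inside n E -> (\sum_(v < n) deg E v = 2 * size E)%N.
Proof.
elim: E => [|[a b] E IH] /=.
  by move=> _; rewrite big1 // => i _; rewrite /deg big_nil.
move=> /andP[/andP[/= ha hb] hE].
under eq_bigr do rewrite deg_cons /=.
by rewrite !big_split /= IH // !sum_eq_ord ha hb; lia.
Qed.

(** Start with all labels distinct and add the edges one at a time, merging the labels of the two
    ends. Each edge loses at most one label, which bounds the number of components from below. *)
Lemma labelling (k : nat) (E : edges) : exists f : nat -> nat,
  (forall u v, adj E u v -> f u = f v) /\
  (k <= size E + size (undup [seq f x | x <- iota 0 k]))%N.
Proof.
elim: E => [|[a b] E [f [hf hk]]].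
  exists id; split => //=; rewrite map_id undup_id ?iota_uniq //.
  by rewrite size_iota.
pose g x := if f x == f a then f b else f x.
exists g; split.
  move=> u v; rewrite adj_cons !xpair_eqE => /or3P[/andP[/eqP-> /eqP->]|/andP[/eqP-> /eqP->]|/hf fuv].
  - by rewrite /g eqxx; case: eqP.
  - by rewrite /g eqxx; case: eqP.
  by rewrite /g fuv.
apply: leq_trans hk _; rewrite /= addSn -addnS leq_add2l.
(* Passing from [f] to [g] can only lose the label [f a]. *)
have <- : size (f a :: undup [seq g x | x <- iota 0 k]) = (size (undup [seq g x | x <- iota 0 k])).+1 by [].
apply: uniq_leq_size; rewrite ?undup_uniq // => y.
rewrite mem_undup => /mapP[x hx ->]; rewrite inE mem_undup.
case: (f x =P f a) => //= hxa; apply/mapP; exists x => //.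
by rewrite /g; case: eqP.
Qed.

Lemma connected_size (k : nat) (E : edges) :
  (forall u v : 'I_k, connect (fun x y : 'I_k => adj E x y) u v) -> (k <= (size E).+1)%N.
Proof.
move=> hc; have [f [hf hk]] := labelling k E.
have fc (u v : 'I_k) : f u = f v.
  have /connectP[p hp ->] := hc u v.
  elim: p u hp => //= w p IH u /andP[/hf -> /IH ->] //.
apply: leq_trans hk _; rewrite -addn1 leq_add2l.
case: k hc fc => [//|k hc fc].
apply: (@leq_trans (size [:: f 0%N])) => //.
apply: uniq_leq_size; rewrite ?undup_uniq // => y.
rewrite mem_undup => /mapP[x + ->]; rewrite mem_iota inE /= add0n => hx.
exact/eqP/(fc (Ordinal hx) ord0).
Qed.

(** If an edge occurred again further on in the list, in either orientation, deleting one copy would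
    leave a connected graph with only [k - 2] edges, against [connected_size]. *)
Lemma tree_simple k E : is_tree k E -> simple E.
Proof.
move=> [/allP hin hsz hc].
have key F1 F2 e : E = F1 ++ e :: F2 -> ~~ adj F2 e.1 e.2.
  move=> hE; apply/negP => hadj.
  have hk : (k <= (size (F1 ++ F2)).+1)%N.
    apply: connected_size => u v; rewrite (eq_connect (e' := fun x y : 'I_k => adj E x y)) //.
    move=> x y /=; rewrite hE /adj !mem_cat !inE.
    suff: ((val x, val y) == e) || ((val y, val x) == e) -> adj F2 x y.
      rewrite /adj; case: (_ == e); case: (_ == e); case: ((x : nat, y : nat) \in F1);
        case: ((y : nat, x : nat) \in F1); case: ((x : nat, y : nat) \in F2); case: ((y : nat, x : nat) \in F2) => //= h;
        by have := h isT.
    case: e hadj {hE} => a b /= h.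
    by rewrite !xpair_eqE => /orP[] /andP[/eqP-> /eqP->] //; rewrite adjC.
  move: hk; have : size E = (size (F1 ++ F2)).+1 by rewrite hE !size_cat /= addnS.
  rewrite hsz; case: (k) (hin e) => [|k' _] /=; last lia.
  by rewrite hE mem_cat inE eqxx orbT => /(_ isT).
have hloop e : e \in E -> e.1 != e.2 by move=> /hin /and3P[].
(* The induction carries the prefix [G] already passed, since [key] and [hloop] speak of the whole
   list. *)
move: key hloop; rewrite -{1 2}(cat0s E); elim: E [::] {hin hsz hc} => //= e F IH G key hl.
rewrite hl ?mem_cat ?inE ?eqxx ?orbT //= (key G F e) //=.
apply: (IH (rcons G e)).
  by move=> F1 F2 e'; rewrite cat_rcons; exact: key.
by move=> e'; rewrite cat_rcons; exact: hl.
Qed.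

(* On trees the degree counted with multiplicity is the number of neighbours,
   which, unlike [deg], only depends on [adj] and hence is isomorphism invariant. *)
Record wf (n : nat) (E : edges) : Prop := Wf {
  wf_inside : inside n E;
  wf_sum : (\sum_(v < n) deg E v = 2 * (n - 1))%N;
  wf_adeg : forall v, (v < n)%N -> deg E v = adeg n E v }.

Lemma tree_inside k E : is_tree k E -> inside k E.
Proof. by move=> [/allP h _ _]; apply/allP => e /h /and3P[-> ->]. Qed.

Lemma tree_wf k E : is_tree k E -> wf k E.
Proof.
move=> hT; have hi := tree_inside hT; have hs := tree_simple hT; split=> //.
  by rewrite sum_deg //; case: hT => _ -> _; rewrite subn1.
by move=> v; apply: simple_adeg.
Qed.

Lemma tree_deg_gt0 k E v : (1 < k)%N -> is_tree k E -> (v < k)%N -> (0 < deg E v)%N.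
Proof.
move=> k1 hT hv; rewrite (wf_adeg (tree_wf hT)) // /adeg.
case: hT => _ _ hc.
have [w hw] : exists w : 'I_k, w != Ordinal hv.
  have k0 : (0 < k)%N by exact: ltnW.
  case: (v =P 0%N) => h.
    by exists (Ordinal k1); rewrite -val_eqE /= h.
  by exists (Ordinal k0); rewrite -val_eqE /= eq_sym; apply/eqP.
have /connectP[[|x p] /=] := hc (Ordinal hv) w.
  by move=> _ e; rewrite e eqxx in hw.
by move=> /andP[h _] _; rewrite (bigD1 x) //= h.
Qed.

Lemma inside_deg0 n E v : inside n E -> (n <= v)%N -> deg E v = 0%N.
Proof.
move=> /allP h hv; rewrite /deg big_seq big1 // => e /h /andP[h1 h2].
by rewrite !ltn_eqF // (leq_trans _ hv).
Qed.

(** Only the degree of [v] changes, and the new vertex is a leaf. The ring is arbitrary because both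
    the integer degree sum and the real statistics need this. *)
Lemma sum_attach (R : pzRingType) n E (v : 'I_n) (f : nat -> R) : inside n E ->
  \sum_(u < n.+1) f (deg ((n, nat_of_ord v) :: E) u) =
  \sum_(u < n) f (deg E u) + (f (deg E v).+1 - f (deg E v)) + f 1%N.
Proof.
move=> hE; rewrite big_ord_recr /= deg_cons /= eqxx (inside_deg0 hE) // ltn_eqF //.
congr (_ + _); apply/eqP; rewrite -subr_eq0 opprD addrA -sumrB /=.
rewrite (bigD1 v) //= deg_cons /= eqxx gtn_eqF // add1n.
rewrite big1 ?addr0 ?subrr // => i hi; rewrite deg_cons /= gtn_eqF ?ltn_ord //.
by rewrite val_eqE eq_sym (negbTE hi) subrr.
Qed.

Lemma wf_attach n E (v : 'I_n) : wf n E -> wf n.+1 ((n, nat_of_ord v) :: E).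
Proof.
move=> [hi hs ha].
have hi' : inside n.+1 ((n, nat_of_ord v) :: E).
  rewrite /= ltnSn ltnS (ltnW (ltn_ord v)) /=; apply: sub_all hi => e /andP[h1 h2].
  by rewrite !ltnS (ltnW h1) (ltnW h2).
split=> //.
  have := sum_attach v (fun d => d%:Z) hi; rewrite -!(big_morph _ PoszD (erefl _)).
  rewrite hs; have := ltn_ord v; move=> h1 h2.
  move: (\sum_(u < n.+1) _)%N h2 => S; move: (deg E v) => d; rewrite (_ : Posz d.+1 - Posz d = 1); last by lia.
  case: n v h1 {E hi hs ha hi'} => [[]|n v _] //; rewrite !subSS !subn0 => h2.
  have {h2} : Posz S = Posz (2 * n + 1 + 1)%N by rewrite h2 !PoszD.
  by case=> ->; rewrite mulnS -addnA addnC.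
move=> x; rewrite ltnS leq_eqVlt /adeg big_ord_recr /= => /orP[/eqP ->|hx].
  rewrite deg_cons /= eqxx (ltn_eqF (ltn_ord v)) (inside_deg0 hi) //.
  rewrite adj_cons !xpair_eqE eqxx gtn_eqF //=.
  have nn u : adj E n u = false.
    by apply/negP => /(inside_adj hi) []; rewrite ltnn.
  rewrite nn (_ : 1 + 0 + 0 = (val v < n))%N; last by rewrite ltn_ord.
  rewrite -sum_eq_ord.
  rewrite addn0; apply: eq_bigr => u _.
  by rewrite adj_cons !xpair_eqE eqxx nn [val u == n]ltn_eqF //= !orbF eq_sym.
have nn : adj E x n = false.
  by apply/negP => /(inside_adj hi) []; rewrite ltnn.
rewrite deg_cons /= (gtn_eqF hx) ha // /adeg addnC add0n; congr (_ + _)%N.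
  apply: eq_bigr => u _; rewrite adj_cons !xpair_eqE.
  by rewrite (ltn_eqF hx) (ltn_eqF (ltn_ord u)).
by rewrite adj_cons !xpair_eqE nn eqxx (ltn_eqF hx) orbF eq_sym.
Qed.

(** * Expectations and total variation *)

Definition Ex (R : realType) (D : seq (R * edges)) (f : edges -> R) : R :=
  \sum_(p <- D) p.1 * f p.2.

(** The transition operator of the process: the conditional mean of [f] after one attachment to the
    tree [E] on [m] vertices. *)
Definition stepE (R : realType) (m : nat) (f : edges -> R) (E : edges) : R :=
  \sum_(v < m) (deg E v)%:R / (2 * (m - 1))%:R * f ((m, nat_of_ord v) :: E).

Record law (R : realType) (m : nat) (D : seq (R * edges)) : Prop := Law {
  law_ge0 : forall p, p \in D -> 0 <= p.1;
  law_wf : forall p, p \in D -> wf m p.2;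
  law_sum : \sum_(p <- D) p.1 = 1 }.

Lemma Ex_step (R : realType) m (D : seq (R * edges)) f :
  Ex (pa_step m D) f = Ex D (stepE m f).
Proof.
rewrite /Ex /pa_step big_flatten big_map; apply: eq_bigr => p _.
rewrite big_map /stepE big_distrr /= -(big_mkord xpredT
  (fun v => p.1 * ((deg p.2 v)%:R / (2 * (m - 1))%:R * f ((m, v) :: p.2)))).
by rewrite /index_iota subn0; apply: eq_bigr => v _; rewrite [RHS]mulrA.
Qed.

Lemma eq_Ex (R : realType) m (D : seq (R * edges)) f g : law m D ->
  (forall E, wf m E -> f E = g E) -> Ex D f = Ex D g.
Proof.
move=> [_ h _] fg; rewrite /Ex big_seq [RHS]big_seq.
by apply: eq_bigr => p /h /fg ->.
Qed.

Lemma ler_Ex (R : realType) m (D : seq (R * edges)) f g : law m D ->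
  (forall E, wf m E -> f E <= g E) -> Ex D f <= Ex D g.
Proof.
move=> [h0 h _] fg; rewrite /Ex big_seq [leRHS]big_seq.
by apply: ler_sum => p hp; rewrite ler_wpM2l ?h0 // fg //; apply: h.
Qed.

Lemma ExD (R : realType) (D : seq (R * edges)) f g :
  Ex D (fun E => f E + g E) = Ex D f + Ex D g.
Proof. by rewrite /Ex -big_split; apply: eq_bigr => p _; rewrite mulrDr. Qed.

Lemma ExZ (R : realType) (D : seq (R * edges)) c f :
  Ex D (fun E => c * f E) = c * Ex D f.
Proof. by rewrite /Ex big_distrr; apply: eq_bigr => p _ /=; rewrite mulrCA. Qed.

Lemma Ex_cst (R : realType) m (D : seq (R * edges)) c : law m D ->
  Ex D (fun=> c) = c.
Proof. by move=> [_ _ h]; rewrite /Ex -big_distrl /= h mul1r. Qed.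

Lemma Ex_ge0 (R : realType) m (D : seq (R * edges)) f : law m D ->
  (forall E, wf m E -> 0 <= f E) -> 0 <= Ex D f.
Proof. by move=> h hf; rewrite -(Ex_cst 0 h); apply: (ler_Ex h). Qed.

Lemma stepE_cst (R : realType) m E (c : R) : (1 < m)%N -> wf m E ->
  stepE m (fun=> c) E = c.
Proof.
move=> hm [_ hs _]; rewrite /stepE -big_distrl -big_distrl -natr_sum /= hs.
by rewrite divff ?mul1r // pnatr_eq0; lia.
Qed.

Lemma law_step (R : realType) m (D : seq (R * edges)) : (1 < m)%N ->
  law m D -> law m.+1 (pa_step m D).
Proof.
move=> hm hD; have [h0 hw h1] := hD.
have mem q : q \in pa_step m D -> exists2 p, p \in D & exists2 v, (v < m)%N &
    q = (p.1 * ((deg p.2 v)%:R / (2 * (m - 1))%:R), (m, v) :: p.2).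
  move=> /flattenP[s /mapP[p hp ->] /mapP[v]].
  by rewrite mem_iota /= add0n => hv ->; exists p => //; exists v.
split=> [_ /mem[p hp [v hv ->]]|_ /mem[p hp [v hv ->]]|] /=.
- by rewrite mulr_ge0 ?h0 // divr_ge0.
- exact: (wf_attach (Ordinal hv) (hw p hp)).
have -> : \sum_(p <- pa_step m D) p.1 = Ex (pa_step m D) (fun=> 1).
  by apply: eq_bigr => p _; rewrite mulr1.
rewrite Ex_step (eq_Ex (g := fun=> 1) hD) ?(Ex_cst _ hD) // => E hE.
exact: stepE_cst.
Qed.

Lemma PA_self (R : realType) k E : PA R k k E = [:: (1, E)].
Proof. by rewrite /PA subnn. Qed.

Lemma PA_succ (R : realType) n k E : (k <= n)%N ->
  PA R n.+1 k E = pa_step n (PA R n k E).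
Proof. by move=> h; rewrite /PA subSn //= subnKC. Qed.

Lemma law_PA (R : realType) n k E : (1 < k)%N -> is_tree k E -> (k <= n)%N ->
  law n (PA R n k E).
Proof.
move=> hk hT; elim: n => [|n IH].
  by rewrite leqn0 => /eqP h; move: hk; rewrite h.
rewrite leq_eqVlt ltnS => /orP[/eqP <-|h].
  rewrite PA_self; split => [p|p|].
  - by rewrite inE => /eqP ->.
  - by rewrite inE => /eqP -> /=; apply: tree_wf.
  - by rewrite big_seq1.
by rewrite PA_succ //; apply: law_step (IH h); apply: leq_trans hk h.
Qed.

Lemma ProbE (R : realType) (D : seq (R * edges)) A :
  Prob D A = Ex D (fun E => (A E)%:R).
Proof.
by apply: eq_bigr => p _; case: (A p.2); rewrite ?mulr1 ?mulr0.
Qed.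

Definition iso_inv (R : Type) (n : nat) (g : edges -> R) : Prop :=
  forall E F, iso n E F -> g E = g F.

(* Layer cake along the finitely many values of [g]. *)
Lemma layer_cake (R : realType) n (P Q : seq (R * edges)) (t c : R) s g :
  law n P -> law n Q ->
  (forall A, iso_invariant n A -> `|Prob P A - Prob Q A| <= t) ->
  path <=%R c s -> iso_inv n g ->
  (forall p, p \in P ++ Q -> g p.2 \in c :: s) ->
  `|Ex P g - Ex Q g| <= (last c s - c) * t.
Proof.
move=> hP hQ ht; elim: s c g => [|c1 s IH] c g /=.
  move=> _ _ hg; rewrite subrr mul0r.
  have cst D m : law m D -> {subset D <= P ++ Q} -> Ex D g = c.
    move=> hD sub; rewrite -(Ex_cst c hD) /Ex big_seq [RHS]big_seq.
    by apply: eq_bigr => p /sub /hg; rewrite inE => /eqP ->.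
  rewrite (cst P n) ?(cst Q n) ?subrr ?normr0 // => p hp; by rewrite mem_cat hp ?orbT.
move=> /andP[cc1 hs] hinv hg.
(* Raising the lowest level [c] to [c1] leaves one level fewer. The change in [g] is a multiple of
   the indicator of [A] minus a constant, so it costs at most [(c1 - c) * t]. *)
pose g' E := Num.max (g E) c1; pose A E := c1 <= g E.
have hmin x : x \in s -> c1 <= x.
  by move: (le_path_min hs) => /allP h /h.
have gE p : p \in P ++ Q -> g p.2 = g' p.2 + (c1 - c) * ((A p.2)%:R - 1).
  move=> /hg; rewrite /g' /A inE => /orP[/eqP ->|hp].
    case: (leP c1 c) => h; last by rewrite sub0r mulrN mulr1; lra.
    by rewrite subrr mulr0 addr0.
  have h : c1 <= g p.2 by move: hp; rewrite inE => /orP[/eqP ->|/hmin].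
  by rewrite h subrr mulr0 addr0; apply/esym/max_idPl.
have cut D : law n D -> {subset D <= P ++ Q} ->
    Ex D g = Ex D g' + (c1 - c) * (Prob D A - 1).
  move=> hD sub; have -> : Prob D A - 1 = Ex D (fun E => (A E)%:R - 1).
    by rewrite (ExD D (fun E => (A E)%:R) (fun=> -1)) (Ex_cst _ hD) ProbE.
  rewrite -ExZ -ExD /Ex big_seq [RHS]big_seq.
  by apply: eq_bigr => p /sub /gE ->.
rewrite (cut P) ?(cut Q) //; try by move=> p hp; rewrite mem_cat hp ?orbT.
have h1 : `|Ex P g' - Ex Q g'| <= (last c1 s - c1) * t.
  apply: IH => // [E F /hinv h|p hp]; first by rewrite /g' h.
  have := hg p hp; rewrite /g' !inE => /orP[/eqP ->|/orP[/eqP ->|hps]].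
  - by rewrite max_r ?eqxx.
  - by rewrite maxxx eqxx.
  - by rewrite max_l ?hps ?orbT // hmin.
have h2 : `|(c1 - c) * (Prob P A - Prob Q A)| <= (c1 - c) * t.
  rewrite normrM ger0_norm ?subr_ge0 // ler_wpM2l ?subr_ge0 //.
  by apply: ht => E F /hinv h; rewrite /A h.
have -> : (last c1 s - c) * t = (last c1 s - c1) * t + (c1 - c) * t by ring.
apply: le_trans (lerD h1 h2); apply: le_trans (ler_normD _ _).
by rewrite le_eqVlt; apply/orP; left; apply/eqP; congr `|_|; ring.
Qed.

(** Starting the layer cake at level 0, below all values, makes its total height at most 1. This
    passes from events to test functions with values between 0 and 1. *)
Lemma iso_Ex_le (R : realType) n (P Q : seq (R * edges)) (t : R) g :
  law n P -> law n Q ->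
  (forall A, iso_invariant n A -> `|Prob P A - Prob Q A| <= t) ->
  iso_inv n g -> (forall E, 0 <= g E <= 1) ->
  `|Ex P g - Ex Q g| <= t.
Proof.
move=> hP hQ ht hinv hg.
have t0 : 0 <= t.
  have -> // : 0 = `|Prob P xpred0 - Prob Q xpred0| by rewrite /Prob !big1 // subrr normr0.
  exact: ht.
set s := sort <=%R [seq g p.2 | p <- P ++ Q].
have hs x : x \in s -> 0 <= x <= 1.
  by rewrite mem_sort => /mapP[p _ ->].
have hpath : path <=%R 0 s.
  rewrite path_min_sorted ?sort_le_sorted //.
  by apply/allP => x /hs /andP[].
have hmem p : p \in P ++ Q -> g p.2 \in 0 :: s.
  by move=> hp; rewrite inE mem_sort (map_f (fun p => g p.2)) ?orbT.
apply: le_trans (layer_cake hP hQ ht hpath hinv hmem) _; rewrite subr0 ler_piMl //.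
have := mem_last 0 s; rewrite inE => /orP[/eqP -> //|/hs /andP[]//].
Qed.

Lemma Prob_bound (R : realType) n (D : seq (R * edges)) A : law n D -> 0 <= Prob D A <= 1.
Proof.
move=> hD; rewrite ProbE (Ex_ge0 hD) //= -[leRHS](Ex_cst 1 hD).
by apply: (ler_Ex hD) => E _; case: (A E).
Qed.

Lemma le_TV (R : realType) n kS ES kT ET A :
  law n (PA R n kS ES) -> law n (PA R n kT ET) -> iso_invariant n A ->
  `|Prob (PA R n kS ES) A - Prob (PA R n kT ET) A| <= TV R n kS ES kT ET.
Proof.
move=> hS hT hA; apply: ub_le_sup; last by exists A.
exists 1 => _ [B [_ ->]].
have /andP[? ?] := Prob_bound B hS; have /andP[? ?] := Prob_bound B hT.
by rewrite ler_norml; apply/andP; split; lra.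
Qed.

Lemma TV_le (R : realType) n kS ES kT ET t :
  (forall A, iso_invariant n A ->
    `|Prob (PA R n kS ES) A - Prob (PA R n kT ET) A| <= t) ->
  TV R n kS ES kT ET <= t.
Proof.
move=> ht; apply: ge_sup => [|_ [A [/ht h ->]] //].
by exists (`|Prob (PA R n kS ES) xpred0 - Prob (PA R n kT ET) xpred0|), xpred0.
Qed.

Lemma TVC (R : realType) n kS ES kT ET : TV R n kS ES kT ET = TV R n kT ET kS ES.
Proof.
by rewrite /TV; congr sup; apply/seteqP; split=> _ [A [hA ->]]; exists A;
  rewrite distrC.
Qed.

(** * Isomorphism invariance and monotonicity in time *)

Lemma adeg_iso n E F (f : {perm 'I_n}) :
  (forall u v : 'I_n, adj E u v = adj F (f u) (f v)) ->
  forall v : 'I_n, adeg n E v = adeg n F (f v).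
Proof.
move=> h v; rewrite /adeg [RHS](reindex_inj (@perm_inj _ f)) /=.
by apply: eq_bigr => u _; rewrite h.
Qed.

Lemma iso_sum_adeg (V : nmodType) n (phi : nat -> V) :
  iso_inv n (fun E => \sum_(v < n) phi (adeg n E v)).
Proof.
move=> E F [f hf]; rewrite [RHS](reindex_inj (@perm_inj _ f)) /=.
by apply: eq_bigr => v _; rewrite (adeg_iso hf).
Qed.

(* [iso n] ignores the edges leaving the vertex set, but [iso n.+1] sees some of them. *)
Definition trunc (n : nat) (E : edges) : edges :=
  [seq e <- E | (e.1 < n)%N && (e.2 < n)%N].

Lemma adj_trunc n E u v : adj (trunc n E) u v = [&& (u < n)%N, (v < n)%N & adj E u v].
Proof.
rewrite /adj !mem_filter /=; case: (u < n)%N; case: (v < n)%N => //=.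
Qed.

(** The isomorphism is extended by fixing the new vertex. *)
Lemma iso_attach n E F (f : {perm 'I_n}) (v : 'I_n) :
  (forall u v : 'I_n, adj E u v = adj F (f u) (f v)) ->
  iso n.+1 ((n, nat_of_ord v) :: trunc n E) ((n, nat_of_ord (f v)) :: trunc n F).
Proof.
move=> hf; exists (lift_perm ord_max ord_max f) => x y.
have L (z : 'I_n.+1) : z = ord_max \/ exists z' : 'I_n, z = lift ord_max z'.
  by case: (unliftP ord_max z) => [z' ->|->]; [right; exists z'|left].
have inj (z w : 'I_n) : (f z == f w :> nat) = (z == w :> nat).
  by rewrite !val_eqE (inj_eq perm_inj).
have ne (z : 'I_n) : (z == n :> nat) = false by rewrite ltn_eqF.
have en (z : 'I_n) : (n == z :> nat) = false by rewrite gtn_eqF.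
rewrite !adj_cons !xpair_eqE !adj_trunc.
case: (L x) => [->|[x' ->]]; case: (L y) => [->|[y' ->]];
  rewrite ?lift_perm_id ?lift_perm_lift ?lift_max /= ?ltnn ?eqxx ?ltn_ord /= ?andbF ?inj ?hf ?ne ?en //.
Qed.

(** Data processing: pulled back through one attachment, the indicator of an invariant event becomes
    an invariant function with values between 0 and 1 of the tree one step earlier. *)
Lemma TV_nonincr (R : realType) n kS ES kT ET :
  (1 < n)%N -> (kS <= n)%N -> (kT <= n)%N ->
  law n (PA R n kS ES) -> law n (PA R n kT ET) ->
  TV R n.+1 kS ES kT ET <= TV R n kS ES kT ET.
Proof.
move=> n1 hkS hkT hS hT; apply: TV_le => A hA.
(* Invariance and bounds are required on all edge lists, not only on trees. Hence [adeg] and [trunc]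
   here, and the minimum with 1 in [g]; on well-formed lists both functions equal the transition
   operator. *)
pose h E : R := \sum_(v < n) (adeg n E v)%:R / (2 * (n - 1))%:R *
  (A ((n, nat_of_ord v) :: trunc n E))%:R.
pose g E : R := Num.min 1 (h E).
have hstep E : wf n E -> stepE n (fun E => (A E)%:R) E = g E.
  move=> hE; have hh : stepE n (fun E => (A E)%:R) E = h E.
    apply: eq_bigr => v _; rewrite (wf_adeg hE) // /trunc.
    by have /all_filterP -> := wf_inside hE.
  rewrite /g -hh; apply/esym/min_idPr; rewrite -[leRHS](stepE_cst 1 n1 hE).
  by apply: ler_sum => v _; rewrite ler_wpM2l ?divr_ge0 //; case: (A _).
rewrite !PA_succ // !ProbE !Ex_step (eq_Ex hS hstep) (eq_Ex hT hstep).
apply: (iso_Ex_le hS hT); first by move=> B; exact: le_TV.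
  move=> E F [f hf]; rewrite /g; congr (Num.min 1 _).
  rewrite /h [RHS](reindex_inj (@perm_inj _ f)) /=; apply: eq_bigr => v _.
  by rewrite (adeg_iso hf) (hA _ _ (iso_attach v hf)).
move=> E; rewrite /g le_min ler01 ge_min lexx /= andbT.
by apply: sumr_ge0 => v _; rewrite mulr_ge0 ?divr_ge0.
Qed.

(* Truncation: [X] is cut at the level [2 V / d], above which it contributes at
   most [d / 2] to either expectation. *)
Lemma second_moment_TV (R : realType) n kS ES kT ET (X : edges -> R) (d V : R) :
  law n (PA R n kS ES) -> law n (PA R n kT ET) -> iso_inv n X ->
  (forall E, 0 <= X E) -> 0 < d -> 0 < V ->
  d <= `|Ex (PA R n kS ES) X - Ex (PA R n kT ET) X| ->
  Ex (PA R n kS ES) (fun E => X E ^+ 2) <= V ->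
  Ex (PA R n kT ET) (fun E => X E ^+ 2) <= V ->
  d ^+ 2 / (4 * V) <= TV R n kS ES kT ET.
Proof.
move=> hS hT hX X0 d0 V0 hd hVS hVT.
pose M := 2 * V / d; have M0 : 0 < M by rewrite divr_gt0 ?mulr_gt0.
pose g E := Num.min 1 (X E / M); pose r E := X E - M * g E.
have XE D : Ex D X = M * Ex D g + Ex D r.
  by rewrite -ExZ -ExD; apply: eq_bigr => p _; rewrite /r addrC subrK.
(* The excess vanishes below level [M], and above it [X - M] is at most [X ^+ 2 / M]; so its mean is
   at most [V / M = d / 2]. *)
have hr E : 0 <= r E <= M^-1 * X E ^+ 2.
  rewrite /r /g; case: (leP 1 (X E / M)) => h.
    rewrite mulr1; rewrite ler_pdivlMr // mul1r in h.
    rewrite subr_ge0 h /= mulrC ler_pdivlMr //.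
    have := sqr_ge0 (X E - M); have := X0 E; nra.
  by rewrite mulrC divfK ?gt_eqF // subrr lexx mulr_ge0 ?sqr_ge0 // invr_ge0 ltW.
have rV D : law n D -> Ex D (fun E => X E ^+ 2) <= V -> 0 <= Ex D r <= d / 2.
  move=> hD hV; rewrite (Ex_ge0 hD) => [/=|E _]; last by have /andP[] := hr E.
  apply: (@le_trans _ _ (M^-1 * V)).
    apply: le_trans (ler_wpM2l _ hV); last by rewrite invr_ge0 ltW.
    by rewrite -ExZ; apply: (ler_Ex hD) => E _; have /andP[] := hr E.
  by rewrite le_eqVlt; apply/orP; left; apply/eqP; rewrite /M; field; rewrite !gt_eqF.
have hg : `|Ex (PA R n kS ES) g - Ex (PA R n kT ET) g| <= TV R n kS ES kT ET.
  apply: (iso_Ex_le hS hT) => [A|E F /hX h|E]; first exact: le_TV.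
    by rewrite /g h.
  by rewrite /g le_min ler01 ge_min lexx /= andbT divr_ge0 // ltW.
have /andP[a1 a2] := rV _ hS hVS; have /andP[b1 b2] := rV _ hT hVT.
have h3 : d <= M * TV R n kS ES kT ET + d / 2.
  apply: le_trans hd _; rewrite !XE.
  have -> : forall a b c e : R, M * a + b - (M * c + e) = M * (a - c) + (b - e) by move=> *; ring.
  apply: le_trans (ler_normD _ _) _; apply: lerD.
    by rewrite normrM gtr0_norm // ler_wpM2l // ltW.
  by rewrite ler_norml; apply/andP; split; lra.
have -> : d ^+ 2 / (4 * V) = d / 2 / M.
  by rewrite /M; field; rewrite !gt_eqF.
by rewrite ler_pdivrMr // mulrC; lra.
Qed.

(** * Moments of degrees *)

Definition dsum (R : realType) (phi : nat -> R) (m : nat) (E : edges) : R :=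
  \sum_(v < m) phi (deg E v).

(** A vertex of degree [d] is chosen with probability [d / (2 * (m - 1))], so this says that one
    step multiplies the conditional mean of [phi] at a given vertex by [1 + s / (m - 1)]. *)
Definition eigen (R : realType) (phi : nat -> R) (s : R) : Prop :=
  forall d, d%:R * (phi d.+1 - phi d) = 2 * s * phi d.

Definition offdiag (R : realType) (phi : nat -> R) (m : nat) (E : edges) : R :=
  dsum phi m E ^+ 2 - dsum (fun d => phi d ^+ 2) m E.

Lemma stepED (R : realType) m (f g : edges -> R) E :
  stepE m (fun E => f E + g E) E = stepE m f E + stepE m g E.
Proof. by rewrite /stepE -big_split; apply: eq_bigr => v _; rewrite mulrDr. Qed.

Lemma stepEZ (R : realType) m c (f : edges -> R) E :
  stepE m (fun E => c * f E) E = c * stepE m f E.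
Proof. by rewrite /stepE big_distrr; apply: eq_bigr => v _ /=; rewrite mulrCA. Qed.

Lemma natr_gt1 (R : realType) m : (1 < m)%N -> 0 < (m - 1)%:R :> R.
Proof. by move=> h; rewrite ltr0n subn_gt0. Qed.

Lemma weighted_sum (R : realType) m E (a b : 'I_m -> R) (s : R) : (1 < m)%N ->
  (forall v : 'I_m, (deg E v)%:R * a v = 2 * s * b v) ->
  \sum_(v < m) (deg E v)%:R / (2 * (m - 1))%:R * a v =
  s / (m - 1)%:R * \sum_(v < m) b v.
Proof.
move=> hm h; rewrite big_distrr; apply: eq_bigr => v _ /=.
rewrite mulrAC h natrM; have := natr_gt1 R hm => h0; field.
by rewrite gt_eqF.
Qed.

Lemma dsum_attach (R : realType) (phi : nat -> R) m E (v : 'I_m) : wf m E ->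
  dsum phi m.+1 ((m, nat_of_ord v) :: E) =
  dsum phi m E + (phi (deg E v).+1 - phi (deg E v)) + phi 1%N.
Proof. by move=> hE; exact: sum_attach (wf_inside hE). Qed.

Lemma stepE_dsum (R : realType) (phi : nat -> R) s m E :
  eigen phi s -> (1 < m)%N -> wf m E ->
  stepE m (dsum phi m.+1) E = (1 + s / (m - 1)%:R) * dsum phi m E + phi 1%N.
Proof.
move=> he hm hE.
transitivity (stepE m (fun=> dsum phi m E + phi 1%N) E +
  \sum_(v < m) (deg E v)%:R / (2 * (m - 1))%:R * (phi (deg E v).+1 - phi (deg E v))).
  rewrite -big_split; apply: eq_bigr => v _ /=; rewrite -mulrDr; congr (_ * _).
  by rewrite dsum_attach // addrAC.
rewrite stepE_cst // (weighted_sum (b := fun v => phi (deg E v)) hm (fun v => he _)).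
by rewrite -/(dsum _ _ _); ring.
Qed.

(** The squared increment of [phi] at the chosen vertex enters both the square of the sum and the
    sum of the squares, and cancels. This is why the diagonal is split off. *)
Lemma stepE_offdiag (R : realType) (phi : nat -> R) s m E :
  eigen phi s -> (1 < m)%N -> wf m E ->
  stepE m (offdiag phi m.+1) E = (1 + 2 * s / (m - 1)%:R) * offdiag phi m E +
    2 * phi 1%N * (1 + s / (m - 1)%:R) * dsum phi m E.
Proof.
move=> he hm hE; pose D (v : 'I_m) := phi (deg E v).+1 - phi (deg E v).
rewrite /stepE /offdiag; under eq_bigr do rewrite !dsum_attach // -/(D _).
have hX2 : \sum_(v < m) phi (deg E v) ^+ 2 = dsum (fun d => phi d ^+ 2) m E by [].
have hX1 : \sum_(v < m) phi (deg E v) = dsum phi m E by [].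
move: (dsum phi m E) (dsum (fun d => phi d ^+ 2) m E) hX1 hX2 => X X2 hX1 hX2.
set a := phi 1%N.
transitivity (stepE m (fun=> X ^+ 2 - X2 + 2 * X * a) E +
  ((2 * X + 2 * a) * \sum_(v < m) (deg E v)%:R / (2 * (m - 1))%:R * D v -
  2 * \sum_(v < m) (deg E v)%:R / (2 * (m - 1))%:R * (phi (deg E v) * D v))).
  rewrite !big_distrr -sumrB -big_split; apply: eq_bigr => v _ /=.
  rewrite /D -/a.
  ring.
rewrite stepE_cst // (weighted_sum (b := fun v => phi (deg E v)) hm (fun v => he _)).
rewrite (weighted_sum (s := s) (b := fun v => phi (deg E v) ^+ 2) hm); last first.
  by move=> v; rewrite /D mulrCA he; ring.
by rewrite hX1 hX2; ring.
Qed.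

(** When [phi 1 = (s - 1) * c], the shift absorbs the contribution of the new leaf; divided by
    [growth], the statistic is then a martingale. *)
Definition mart (R : realType) (phi : nat -> R) (c : R) (m : nat) (E : edges) : R :=
  dsum phi m E + c * (m - 1)%:R.

Lemma natr_predS (R : realType) m : (1 < m)%N -> (m.+1 - 1)%:R = (m - 1)%:R + 1 :> R.
Proof. by move=> h; rewrite natr1; congr (_%:R); lia. Qed.

Lemma stepE_mart (R : realType) (phi : nat -> R) s c m E :
  eigen phi s -> phi 1%N = (s - 1) * c -> (1 < m)%N -> wf m E ->
  stepE m (mart phi c m.+1) E = (1 + s / (m - 1)%:R) * mart phi c m E.
Proof.
move=> he h1 hm hE; rewrite /mart stepED (stepE_cst _ hm hE) (stepE_dsum he) // h1.
by rewrite natr_predS //; have := natr_gt1 R hm => h0; field; rewrite gt_eqF.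
Qed.

(* The multiple of [mart] absorbs the linear term in [stepE_offdiag]. *)
Definition quad (R : realType) (phi : nat -> R) (s c : R) (m : nat) (E : edges) : R :=
  offdiag phi m E + 2 * c * ((m - 1)%:R + s) * mart phi c m E.

Lemma stepE_quad (R : realType) (phi : nat -> R) s c m E :
  eigen phi s -> phi 1%N = (s - 1) * c -> 1 <= s -> 0 <= c -> (1 < m)%N -> wf m E ->
  stepE m (quad phi s c m.+1) E <= (1 + 2 * s / (m - 1)%:R) * quad phi s c m E.
Proof.
move=> he h1 s1 c0 hm hE; rewrite /quad stepED (stepE_offdiag he) // stepEZ.
rewrite (stepE_mart he h1) // h1 natr_predS //; have N0 := natr_gt1 R hm.
rewrite -subr_ge0; set N := (m - 1)%:R in N0 *.
(* The coefficient in [quad] makes the terms in [dsum] cancel. The slack comes from the shift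
   [c * N] in [mart] alone. *)
rewrite (_ : _ - _ = 2 * (s - 1) * c * (1 + s / N) * (c * N)).
  have s0 : 0 <= s by lra.
  by rewrite !mulr_ge0 ?subr_ge0 ?addr_ge0 ?divr_ge0 ?(ltW N0).
rewrite /mart -/N; field; by rewrite gt_eqF.
Qed.

(** The square of [dsum] is [offdiag] plus a diagonal, and the diagonal is below [dsum phi2]. The
    cross term and the squared shift are covered by the multiple of [mart] inside [quad]. *)
Lemma mart_sqr_le (R : realType) (phi phi2 : nat -> R) s c c2 m E :
  (forall d, 0 <= phi d) -> (forall d, phi d ^+ 2 <= phi2 d) ->
  0 <= s -> 0 <= c -> 0 <= c2 ->
  mart phi c m E ^+ 2 <= quad phi s c m E + mart phi2 c2 m E.
Proof.
move=> h0 h2 s0 c0 c20; rewrite /quad /offdiag /mart.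
have hX : 0 <= dsum phi m E by apply: sumr_ge0.
have hX2 : dsum (fun d => phi d ^+ 2) m E <= dsum phi2 m E by apply: ler_sum.
set X := dsum phi m E in hX *; set N : R := (m - 1)%:R.
have N0 : 0 <= N by [].
have cN : 0 <= c * N by rewrite mulr_ge0.
have cs : 0 <= c * s by rewrite mulr_ge0.
have c2N : 0 <= c2 * N by rewrite mulr_ge0.
have h : 0 <= c * s * (X + c * N) by rewrite mulr_ge0 ?addr_ge0.
have h' : 0 <= (c * N) ^+ 2 by rewrite sqr_ge0.
nra.
Qed.

Definition growth (R : realType) (s : R) (k n : nat) : R :=
  \prod_(k <= i < n) (1 + s / (i - 1)%:R).

Lemma growth_gt0 (R : realType) (s : R) k n : 0 <= s -> 0 < growth s k n.
Proof.
by move=> s0; apply: prodr_gt0 => i _; rewrite ltr_pwDl // divr_ge0.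
Qed.

Lemma Ex_mart (R : realType) (phi : nat -> R) s c l E k n :
  eigen phi s -> phi 1%N = (s - 1) * c ->
  (1 < l)%N -> is_tree l E -> (l <= k <= n)%N ->
  Ex (PA R n l E) (mart phi c n) = growth s k n * Ex (PA R k l E) (mart phi c k).
Proof.
move=> he h1 hl hT /andP[lk]; elim: n => [|n IH].
  by rewrite leqn0 => /eqP ->; rewrite /growth big_geq ?mul1r.
rewrite leq_eqVlt ltnS => /orP[/eqP ->|kn]; first by rewrite /growth big_geq ?mul1r.
have ln := leq_trans lk kn.
rewrite PA_succ // Ex_step (eq_Ex (law_PA R hl hT ln)
  (fun E hE => stepE_mart he h1 (leq_trans hl ln) hE)) ExZ IH //.
by rewrite /growth big_nat_recr //= mulrCA mulrA.
Qed.

Lemma Ex_quad (R : realType) (phi : nat -> R) s c l E k n :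
  eigen phi s -> phi 1%N = (s - 1) * c -> 1 <= s -> 0 <= c ->
  (1 < l)%N -> is_tree l E -> (l <= k <= n)%N ->
  Ex (PA R n l E) (quad phi s c n) <=
    growth (2 * s) k n * Ex (PA R k l E) (quad phi s c k).
Proof.
move=> he h1 s1 c0 hl hT /andP[lk]; elim: n => [|n IH].
  by rewrite leqn0 => /eqP ->; rewrite /growth big_geq ?mul1r.
rewrite leq_eqVlt ltnS => /orP[/eqP ->|kn]; first by rewrite /growth big_geq ?mul1r.
have ln := leq_trans lk kn.
rewrite PA_succ // Ex_step; apply: le_trans (ler_Ex (law_PA R hl hT ln)
  (fun E hE => stepE_quad he h1 s1 c0 (leq_trans hl ln) hE)) _.
rewrite ExZ /growth big_nat_recr //= [leRHS]mulrAC [leLHS]mulrC.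
apply: ler_wpM2r; last exact: IH.
by rewrite addr_ge0 // divr_ge0 // mulr_ge0 //; lra.
Qed.

(** Factor by factor, [1 + 2 * x <= (1 + x) ^+ 2]. Thus second moments grow no faster than squared
    means. *)
Lemma growth_double (R : realType) (s : R) k n : 0 <= s ->
  growth (2 * s) k n <= growth s k n ^+ 2.
Proof.
move=> s0; rewrite /growth -prodrXl; apply: ler_prod => i _.
have h : 0 <= s / (i - 1)%:R by rewrite divr_ge0.
rewrite -mulrA; apply/andP; split; nra.
Qed.

(** * Rising factorials and separation of the means *)

Definition rising (d r : nat) : nat := (\prod_(i < r) (d + i))%N.

(** Both sides are the product of [d], [d + 1], ..., [d + r]. *)
Lemma rising_succ d r : (d * rising d.+1 r = (d + r) * rising d r)%N.
Proof.
rewrite [RHS]mulnC; transitivity (\prod_(i < r.+1) (d + i))%N; last by rewrite big_ord_recr.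
rewrite big_ord_recl addn0; congr (_ * _)%N.
by apply: eq_bigr => i _; rewrite /= addSnnS.
Qed.

Lemma rising_gt0 d r : (0 < d)%N -> (0 < rising d r)%N.
Proof. by move=> d0; apply: prodn_gt0 => i; rewrite addn_gt0 d0. Qed.

(** The last [r] factors on the right dominate the first [r]. This supplies [phi2] for
    [mart_sqr_le], again a rising factorial and hence an eigenfunction. *)
Lemma rising_sqr d r : (rising d r ^ 2 <= rising d (2 * r))%N.
Proof.
rewrite mul2n -addnn /rising big_split_ord /= expnS expn1 leq_mul2l; apply/orP; right.
by apply: leq_prod => i _; rewrite leq_add2l leq_addl.
Qed.

Lemma rising_eigen (R : realType) s :
  eigen (fun d => (rising d (2 * s))%:R) (s%:R : R).
Proof.
move=> d; rewrite mulrBr -!natrM rising_succ -natrB; last by rewrite mulnDl leq_addr.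
by rewrite mulnDl addKn.
Qed.

(** From time [kT] on, the difference of means scales exactly by [growth] and the second moments at
    most by its square, so the bound of [second_moment_TV] does not depend on [n]. *)
Lemma moment_TV (R : realType) kS ES kT ET s :
  (1 < kS)%N -> (kS <= kT)%N -> is_tree kS ES -> is_tree kT ET -> (1 < s)%N ->
  Ex (PA R kT kS ES) (dsum (fun d => (rising d (2 * s))%:R) kT) !=
    dsum (fun d => (rising d (2 * s))%:R) kT ET ->
  exists2 e : R, 0 < e & forall n, (kT <= n)%N -> e <= TV R n kS ES kT ET.
Proof.
move=> hkS hST hS hT hs hne.
pose phi d : R := (rising d (2 * s))%:R; pose phi2 d : R := (rising d (2 * (2 * s)))%:R.
have he : eigen phi s%:R by exact: rising_eigen.
have he2 : eigen phi2 (2 * s%:R) by rewrite -natrM; exact: rising_eigen.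
have s1 : 1 < s%:R :> R by rewrite ltr1n.
pose c := phi 1%N / (s%:R - 1); pose c2 := phi2 1%N / (2 * s%:R - 1).
have h1 : phi 1%N = (s%:R - 1) * c by rewrite mulrC divfK // gt_eqF // subr_gt0.
have h12 : phi2 1%N = (2 * s%:R - 1) * c2 by rewrite mulrC divfK // gt_eqF //; lra.
have c0 : 0 <= c by rewrite divr_ge0 ?subr_ge0 // ltW.
have c20 : 0 <= c2 by rewrite divr_ge0 //; lra.
have phisq d : phi d ^+ 2 <= phi2 d by rewrite -natrX ler_nat rising_sqr.
have hkT := leq_trans hkS hST.
have lawS n : (kT <= n)%N -> law n (PA R n kS ES).
  by move=> h; apply: law_PA => //; apply: leq_trans h.
have lawT n : (kT <= n)%N -> law n (PA R n kT ET) by exact: law_PA.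
pose Z n E := quad phi s%:R c n E + mart phi2 c2 n E.
pose g n : R := growth s%:R kT n.
have g0 n : 0 < g n by apply: growth_gt0.
have ExE D n : Ex D (Z n) = Ex D (quad phi s%:R c n) + Ex D (mart phi2 c2 n) by exact: ExD.
have ExZn l E n : (1 < l)%N -> is_tree l E -> (l <= kT <= n)%N ->
    Ex (PA R n l E) (Z n) <= g n ^+ 2 * Ex (PA R kT l E) (Z kT).
  move=> hl hE hn; rewrite ExE (Ex_mart he2 h12 hl hE hn).
  have hq := Ex_quad he h1 (ltW s1) c0 hl hE hn.
  have := lerD hq (lexx (growth (2 * s%:R) kT n * Ex (PA R kT l E) (mart phi2 c2 kT))).
  rewrite -mulrDr -ExE => h; apply: le_trans h _; apply: ler_wpM2r.
    apply: (Ex_ge0 (law_PA R hl hE _)) => [|F _]; first by case/andP: hn.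
    apply: le_trans (mart_sqr_le (phi := phi) kT F _ phisq (ltW (lt_trans ltr01 s1)) c0 c20).
      exact: sqr_ge0.
    by [].
  by apply: growth_double.
pose V := 1 + Ex (PA R kT kS ES) (Z kT) + Ex (PA R kT kT ET) (Z kT).
have Z0 n E : mart phi c n E ^+ 2 <= Z n E by apply: mart_sqr_le => //; lra.
have ZS0 : 0 <= Ex (PA R kT kS ES) (Z kT).
  by apply: (Ex_ge0 (lawS _ (leqnn _))) => E _; apply: le_trans (Z0 _ _); exact: sqr_ge0.
have ZT0 : 0 <= Ex (PA R kT kT ET) (Z kT).
  by apply: (Ex_ge0 (lawT _ (leqnn _))) => E _; apply: le_trans (Z0 _ _); exact: sqr_ge0.
have V0 : 0 < V by rewrite /V; lra.
pose d := `|Ex (PA R kT kS ES) (mart phi c kT) - Ex (PA R kT kT ET) (mart phi c kT)|.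
(* The deterministic shift in [mart] is the same for both seeds and drops out. *)
have d0 : 0 < d.
  rewrite normr_gt0 /mart !ExD !(Ex_cst _ (lawS _ (leqnn _))) !(Ex_cst _ (lawT _ (leqnn _))).
  rewrite opprD addrACA subrr addr0 subr_eq0 PA_self [X in _ != X]/Ex big_seq1 mul1r.
  exact: hne.
exists (d ^+ 2 / (4 * V)) => [|n hn]; first by rewrite divr_gt0 ?exprn_gt0 ?mulr_gt0.
(* The normalized [mart], written with [adeg] so that it is invariant on every edge list. *)
pose X E : R := (g n)^-1 * (\sum_(v < n) phi (adeg n E v) + c * (n - 1)%:R).
have XE E : wf n E -> X E = (g n)^-1 * mart phi c n E.
  move=> hE; congr (_ * (_ + _)); apply: eq_bigr => v _.
  by rewrite (wf_adeg hE).
have XE2 E : wf n E -> X E ^+ 2 <= (g n)^-1 ^+ 2 * Z n E.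
  by move=> /XE ->; rewrite exprMn ler_wpM2l ?sqr_ge0 // Z0.
have V2 l E : (1 < l)%N -> is_tree l E -> (l <= kT)%N -> law n (PA R n l E) ->
    Ex (PA R kT l E) (Z kT) <= V -> Ex (PA R n l E) (fun E => X E ^+ 2) <= V.
  move=> hl hE hlk hlaw; apply: le_trans; apply: le_trans (ler_Ex hlaw XE2) _.
  rewrite ExZ exprVn mulrC ler_pdivrMr ?exprn_gt0 // mulrC.
  by apply: ExZn => //; rewrite hlk.
apply: (@second_moment_TV _ _ _ _ _ _ X) => //.
- exact: lawS.
- exact: lawT.
- by move=> E F h; rewrite /X (iso_sum_adeg phi h).
- move=> E; apply: mulr_ge0; first by rewrite invr_ge0 ltW.
  by apply: addr_ge0; [apply: sumr_ge0 => v _; exact: ler0n | exact: mulr_ge0].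
- rewrite (eq_Ex (lawS _ hn) XE) (eq_Ex (lawT _ hn) XE) !ExZ.
  have hSn : (kS <= kT <= n)%N by rewrite hST.
  have hTn : (kT <= kT <= n)%N by rewrite leqnn.
  rewrite (Ex_mart he h1 hkS hS hSn) (Ex_mart he h1 hkT hT hTn).
  by rewrite !mulrA mulVf ?gt_eqF // !mul1r.
- by apply: V2 => //; [exact: lawS|rewrite /V; lra].
- by apply: V2 => //; [exact: lawT|rewrite /V; lra].
Qed.

(** * Separating the seeds *)

Definition dcount (R : realType) (d m : nat) (E : edges) : R :=
  dsum (fun e => (e == d)%:R) m E.

Lemma dcountE (R : realType) d m E :
  dcount R d m E = (\sum_(v < m) (deg E v == d))%N%:R.
Proof. by rewrite natr_sum. Qed.

Lemma wf_deg m E v : wf m E -> (v < m)%N -> (deg E v <= 2 * (m - 1))%N.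
Proof.
move=> [_ <- _] hv; rewrite (bigD1 (Ordinal hv)) //=; exact: leq_addr.
Qed.

Lemma dsum_dcount (R : realType) (phi : nat -> R) m E B : wf m E -> (2 * m <= B)%N ->
  dsum phi m E = \sum_(d < B) phi d * dcount R d m E.
Proof.
move=> hE hB; under eq_bigr do rewrite /dcount /dsum big_distrr.
rewrite exchange_big; apply: eq_bigr => v _ /=.
have hd : (deg E v < B)%N by have := wf_deg hE (ltn_ord v); have := ltn_ord v; lia.
rewrite (bigD1 (Ordinal hd)) //= eqxx mulr1 big1 ?addr0 // => d /negPf h.
by rewrite eq_sym (_ : (val d == deg E v) = false) ?mulr0 // -h -val_eqE.
Qed.

Lemma Ex_sum (R : realType) (D : seq (R * edges)) B (f : 'I_B -> edges -> R) :
  Ex D (fun E => \sum_(d < B) f d E) = \sum_(d < B) Ex D (f d).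
Proof.
by rewrite /Ex exchange_big; apply: eq_bigr => p _; rewrite big_distrr.
Qed.

Lemma leq_rising d e r : (d <= e)%N -> (rising d r <= rising e r)%N.
Proof. by move=> h; apply: leq_prod => i _; rewrite leq_add2r. Qed.

(** The left side is at most [(d + r) * rising d r], which is [d * rising d.+1 r]. For fixed [d < e]
    the smaller rising factorial is thus smaller by a factor of order [1 / r]. *)
Lemma rising_ratio d e r : (d < e)%N -> (r * rising d r <= e * rising e r)%N.
Proof.
move=> de; apply: (@leq_trans (d * rising d.+1 r)).
  by rewrite rising_succ leq_mul2r leq_addl orbT.
by rewrite leq_mul // ?leq_rising // ltnW.
Qed.

(* For large [s] the sum is dominated by the largest [d] with [a d != 0]. *)
Lemma rising_separates (R : realType) (a : nat -> R) B d0 :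
  (0 < d0 < B)%N -> a d0 != 0 ->
  exists2 s, (1 < s)%N & \sum_(d < B) (rising d (2 * s))%:R * a d != 0.
Proof.
move=> + ha; elim: B => [|B IH] h; first by lia.
case: (eqVneq (a B) 0) => aB.
  have [|s s1 hs] := IH.
    case/andP: h => h; rewrite ltnS leq_eqVlt => /orP[/eqP e|->]; last by rewrite h.
    by move: ha; rewrite e aB eqxx.
  by exists s => //; rewrite big_ord_recr /= aB mulr0 addr0.
have B0 : (0 < B)%N by lia.
(* If the sum vanished, the top term would balance the others, and [rising_ratio] would give
   [2 * s <= x]; so [s] is taken above [x]. *)
pose S := \sum_(d < B) `|a d|; pose x := S * B%:R / `|a B|.
have x0 : 0 <= x by rewrite divr_ge0 ?mulr_ge0 ?sumr_ge0.
pose s := (Num.bound x).+2; exists s => //.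
rewrite big_ord_recr /= addr_eq0; apply/eqP => hsum.
have a0 : 0 < `|a B| by rewrite normr_gt0.
pose rB : R := (rising B (2 * s))%:R.
have rB0 : 0 < rB by rewrite ltr0n rising_gt0.
have h1 : (2 * s)%:R * (rB * `|a B|) <= S * (B%:R * rB).
  have -> : rB * `|a B| = `|\sum_(d < B) (rising d (2 * s))%:R * a d|.
    by rewrite hsum normrN normrM [`|rB|]gtr0_norm.
  apply: (@le_trans _ _ ((2 * s)%:R * \sum_(d < B) `|(rising d (2 * s))%:R * a d|)).
    by rewrite ler_wpM2l // ler_norm_sum.
  rewrite big_distrr /S big_distrl; apply: ler_sum => d _ /=.
  rewrite normrM normr_nat mulrA [leRHS]mulrC ler_wpM2r // -!natrM ler_nat.
  exact: rising_ratio.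
have h2 : (2 * s)%:R <= x.
  rewrite /x ler_pdivlMr // -(ler_pM2r rB0); apply: le_trans (le_trans h1 _).
    by rewrite -mulrA [rB * _]mulrC.
  by rewrite mulrA.
have := archi_boundP x0; rewrite ltNge => /negP; apply.
by apply: le_trans h2; rewrite ler_nat /s; lia.
Qed.

Lemma eq_Ex_in (R : realType) (D : seq (R * edges)) f g :
  (forall p, p \in D -> f p.2 = g p.2) -> Ex D f = Ex D g.
Proof.
by move=> fg; rewrite /Ex big_seq [RHS]big_seq; apply: eq_bigr => p /fg ->.
Qed.

Lemma PA_deg_le (R : realType) k E d j p : (forall v, (deg E v <= d)%N) ->
  p \in PA R (k + j) k E -> forall v, (deg p.2 v <= d + j)%N.
Proof.
move=> hd; elim: j p => [|j IH] p.
  by rewrite !addn0 PA_self inE => /eqP ->.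
rewrite addnS PA_succ ?leq_addr // => /flattenP[s /mapP[q hq ->] /mapP[v]].
rewrite mem_iota /= add0n => hv -> u /=; rewrite deg_cons /=.
have h := IH q hq u; rewrite addnS; case: eqP => [e|_].
  by rewrite -e (ltn_eqF hv) addn0 add1n ltnS e.
by case: (v == u); rewrite ?add1n ?add0n ?ltnS // ltnW.
Qed.

(** No vertex has degree [d + j.+1] before this step, and the new leaf does not have it either as
    [d > 0]. So the step creates one exactly when it hits a vertex of degree [d + j]. *)
Lemma Ex_dcount_top (R : realType) k E d j : (1 < k)%N -> is_tree k E ->
  (0 < d)%N -> (forall v, (deg E v <= d)%N) ->
  Ex (PA R (k + j.+1) k E) (dcount R (d + j.+1) (k + j.+1)) =
  (d + j)%:R / (2 * (k + j - 1))%:R * Ex (PA R (k + j) k E) (dcount R (d + j) (k + j)).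
Proof.
move=> hk hT d0 hd; rewrite addnS PA_succ ?leq_addr // Ex_step -ExZ.
have hl := law_PA R hk hT (leq_addr j k).
apply: eq_Ex_in => p hp; have hdeg := PA_deg_le hd hp.
rewrite /stepE [in RHS]/dcount [in RHS]/dsum big_distrr; apply: eq_bigr => v _ /=.
rewrite /dcount dsum_attach; last exact: law_wf hp.
rewrite /dsum big1 => [|u _]; last first.
  by rewrite ltn_eqF // addnS ltnS hdeg.
rewrite addnS eqSS [deg p.2 v == _.+1]ltn_eqF ?ltnS ?hdeg //.
rewrite (_ : (1 == _)%N = false) ?subr0 ?add0r ?addr0; last by lia.
by case: eqP => [->|_]; rewrite ?mulr1 ?mulr0.
Qed.

(** All degrees are positive and sum to [2 * (k - 1)], so equality would force every degree to be
    [d]. Then [k * d = 2 * (k - 1)], which is impossible for [k > 2]. *)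
Lemma max_deg_count k E d : (2 < k)%N -> is_tree k E -> (0 < d)%N ->
  (d * \sum_(v < k) (deg E v == d) < 2 * (k - 1))%N.
Proof.
move=> hk hT d0; rewrite -(wf_sum (tree_wf hT)) big_distrr /=.
have le (v : 'I_k) : (d * (deg E v == d) <= deg E v)%N.
  by case: eqP => [->|_]; rewrite ?muln1 ?muln0.
case: (boolP [exists v : 'I_k, deg E v != d]) => [/existsP[v hv]|].
  rewrite [X in (X < _)%N](bigD1 v) // [X in (_ < X)%N](bigD1 v) //= (negbTE hv) muln0 add0n.
  have hv0 : (0 < deg E v)%N by apply: tree_deg_gt0 hT _ => //; exact: ltnW.
  by rewrite -[X in (X < _)%N]add0n -addSn leq_add // leq_sum.
rewrite negb_exists => /forallP h.
have hd (v : 'I_k) : deg E v = d by have := h v; rewrite negbK => /eqP.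
have hs : (k * d = 2 * (k - 1))%N.
  rewrite -(wf_sum (tree_wf hT)) (eq_bigr (fun=> d)) => [|v _]; last exact: hd.
  by rewrite sum_nat_const card_ord.
exfalso; case: (ltnP d 2) => d2.
  have e : d = 1%N by lia.
  by move: hs; rewrite e muln1; lia.
by have : (k * 2 <= k * d)%N; [rewrite leq_mul2l d2 orbT|lia].
Qed.

(* The maximal degree plus [j] is reached after [j] steps only by attaching
   repeatedly to one of the vertices of maximal degree. *)
Lemma Ex_dcount_top_lt1 (R : realType) k E d j : (2 < k)%N -> is_tree k E ->
  (forall v, (deg E v <= d)%N) -> (exists2 v, (v < k)%N & deg E v = d) ->
  0 < Ex (PA R (k + j.+1) k E) (dcount R (d + j.+1) (k + j.+1)) < 1.
Proof.
move=> hk hT hd [v hv hdv]; have k1 : (1 < k)%N by exact: ltnW.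
have d0 : (0 < d)%N by rewrite -hdv (tree_deg_gt0 k1 hT).
have pos i : 0 < (2 * (k + i - 1))%:R :> R by rewrite ltr0n; lia.
elim: j => [|j /andP[IH0 IH1]]; rewrite Ex_dcount_top //.
  rewrite !addn0 PA_self [Ex _ _]big_seq1 /= mul1r dcountE mulrAC -natrM.
  have := pos 0%N; rewrite addn0 => p0; apply/andP; split.
    rewrite divr_gt0 // ltr0n muln_gt0 d0 (bigD1 (Ordinal hv)) //= hdv eqxx.
    by [].
  by rewrite ltr_pdivrMr // mul1r ltr_nat max_deg_count.
(* The base case is strict by [max_deg_count]; each later factor is at most 1 because [d] is at most
   the degree sum of the seed. *)
have dk : (d <= 2 * (k - 1))%N by rewrite -hdv (wf_deg (tree_wf hT)).
have dj : (0 < d + j.+1)%N by lia.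
rewrite pmulr_rgt0 ?IH0 ?divr_gt0 ?ltr0n //=; last by rewrite -(ltr0n R); exact: pos.
apply: le_lt_trans IH1; rewrite ler_piMl ?(ltW IH0) // ler_pdivrMr // mul1r ler_nat.
lia.
Qed.

Lemma count_deg k E d :
  count_mem d [seq deg E v | v <- iota 0 k] = (\sum_(v < k) (deg E v == d))%N.
Proof.
rewrite count_map -sum1_count big_mkcond -(big_mkord xpredT (fun v => deg E v == d : nat)).
by rewrite /index_iota subn0; apply: eq_bigr => v _ /=; case: eqP.
Qed.

(** Sorting would identify the two degree lists if they were permutations of each other. Positivity
    of [d] matters because [rising 0 r] vanishes for [r > 0]. *)
Lemma dprof_count k ES ET : (1 < k)%N -> is_tree k ES -> is_tree k ET ->
  dprof k ES <> dprof k ET ->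
  exists2 d, (0 < d)%N & (\sum_(v < k) (deg ES v == d) <> \sum_(v < k) (deg ET v == d))%N.
Proof.
move=> hk hS hT hne.
have /allPn[d hd] : ~~ perm_eq [seq deg ES v | v <- iota 0 k] [seq deg ET v | v <- iota 0 k].
  apply/negP => hp; apply: hne; rewrite /dprof.
  have -> // : sort geq [seq deg ES v | v <- iota 0 k] = sort geq [seq deg ET v | v <- iota 0 k].
  apply/perm_sortP => //; first by move=> x y; rewrite /geq; lia.
    by move=> x y z; rewrite /geq /=; lia.
  by move=> x y; rewrite /geq /=; lia.
rewrite /= !count_deg => /eqP h; exists d => //.
by move: hd; rewrite mem_cat => /orP[] /mapP[v]; rewrite mem_iota add0n => hv ->;
  [apply: tree_deg_gt0 hS _|apply: tree_deg_gt0 hT _].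
Qed.

Lemma seed_TV (R : realType) kS ES kT ET :
  (2 < kS)%N -> (kS <= kT)%N -> is_tree kS ES -> is_tree kT ET ->
  dprof kS ES <> dprof kT ET ->
  exists2 e : R, 0 < e & forall n, (kT <= n)%N -> e <= TV R n kS ES kT ET.
Proof.
move=> hkS hST hS hT hne; have k1 : (1 < kS)%N by exact: ltnW.
pose a d := Ex (PA R kT kS ES) (dcount R d kT) - dcount R d kT ET.
have [d d0 ad] : exists2 d, (0 < d)%N & a d != 0.
  move: hST; rewrite leq_eqVlt => /orP[/eqP ek|hlt].
    subst kT; have [d d0 hd] := dprof_count k1 hS hT hne.
    exists d => //; rewrite /a PA_self [Ex _ _]big_seq1 mul1r !dcountE subr_eq0.
    by rewrite eqr_nat; apply/eqP.
  pose d := (\max_(v < kS) deg ES v)%N.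
  have hd v : (deg ES v <= d)%N.
    case: (ltnP v kS) => hv; first exact: (leq_bigmax (Ordinal hv)).
    by rewrite (inside_deg0 (tree_inside hS)).
  have hv : exists2 v, (v < kS)%N & deg ES v = d.
    have [|v ev] := @bigop.eq_bigmax _ (fun v : 'I_kS => deg ES v).
      by rewrite card_ord; exact: ltnW.
    by exists v => //; rewrite /d ev.
  have [j ej] : exists j, kT = (kS + j.+1)%N by exists (kT - kS).-1; lia.
  subst kT; have := Ex_dcount_top_lt1 R j hkS hS hd hv => h.
  exists (d + j.+1)%N; first by rewrite addnS.
  rewrite /a subr_eq0; apply/eqP => e; move: h; rewrite e dcountE ltr0n ltrn1.
  by lia.
(* The bound [B] exceeds both [d] and every degree of a tree on [kT] vertices. *)
have [s s1 hs] := rising_separates (B := maxn d.+1 (2 * kT)) (a := a) (d0 := d)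
  ltac:(lia) ad.
apply: (moment_TV (s := s)) => //; apply: contra_neq hs => e.
have hlaw := law_PA R k1 hS hST; have hB : (2 * kT <= maxn d.+1 (2 * kT))%N by lia.
move: e; rewrite (eq_Ex hlaw (fun E hE => dsum_dcount _ hE hB)).
rewrite (dsum_dcount _ (tree_wf hT) hB) Ex_sum => e.
by under eq_bigr do rewrite /a mulrBr -ExZ; rewrite sumrB e subrr.
Qed.

Lemma delta_gt0 (R : realType) kS ES kT ET (e : R) :
  (1 < kS)%N -> (1 < kT)%N -> is_tree kS ES -> is_tree kT ET -> 0 < e ->
  (forall n, (maxn kS kT <= n)%N -> e <= TV R n kS ES kT ET) ->
  0 < delta R kS ES kT ET.
Proof.
move=> hkS hkT hS hT e0 he; pose K := maxn kS kT.
pose u n : R := TV R n kS ES kT ET.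
have hl n : (K <= n)%N -> u n.+1 <= u n.
  rewrite /K geq_max => /andP[h1 h2]; apply: TV_nonincr => //.
  - exact: leq_trans h1.
  - exact: law_PA.
  - exact: law_PA.
(* Below [K] the truncated subtraction in [PA] leaves a seed ungrown, so monotonicity is used only
   from [K] on. Convergence has to be proved, since [limn] of a divergent sequence is a default
   value. *)
have cvg_shift : cvgn [sequence u (n + K)%N]_n.
  apply: nonincreasing_is_cvgn.
    by apply/nonincreasing_seqP => n; rewrite /= addSn; apply: hl; rewrite leq_addl.
  by exists e => _ [n _ <-]; apply: he; rewrite leq_addl.
have hu : cvgn u.
  by move: cvg_shift => /cvg_ex[l]; rewrite cvg_shiftn => hl'; apply/cvg_ex; exists l.
apply: lt_le_trans e0 _; apply: limr_ge => //.
by exists K => // n /= hn; apply: he.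
Qed.

Unset Implicit Arguments.

Theorem theorem2 (R : realType) (kS : nat) (ES : edges) (kT : nat) (ET : edges) :
  (3 <= kS)%N -> (3 <= kT)%N -> is_tree kS ES -> is_tree kT ET ->
  dprof kS ES <> dprof kT ET ->
  0 < delta R kS ES kT ET.
Proof.
move=> hkS hkT hS hT hne.
have [e e0 he] : exists2 e : R, 0 < e &
    forall n, (maxn kS kT <= n)%N -> e <= TV R n kS ES kT ET.
  case: (leqP kS kT) => h; first exact: seed_TV.
  have [e e0 he] := seed_TV R hkT (ltnW h) hT hS (nesym hne).
  by exists e => // n hn; rewrite TVC; apply: he.
by apply: delta_gt0 e0 he => //; exact: ltnW.
Qed.
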